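(* Let $A\neq B$ be points of $\mathcal{P}$ and let $P$ be any point on the line $l=l_{AB}$. Then there exists a unique point $K$ on $l_{AB}$ such that $\overrightarrow{AB}\;\Re_l\;\overrightarrow{PK}$, and likewise there exists a unique point $K'$ on $l_{AB}$ such that $\overrightarrow{AB}\;\Re_l\;\overrightarrow{K'P}$.
   Context: Let $\mathcal{P}$ be a set whose elements are called points. An arrow is an ordered pair of points $\overrightarrow{AB}=(A,B)$ (tail $A$, head $B$; $A=B$ is allowed). The arrow space $\mathcal{P}_A$ is the set of all arrows; two arrows are equal iff they have the same tail and the same head. Negation: $-\overrightarrow{AB}=\overrightarrow{BA}$. Arrow addition is the partial operation $\overrightarrow{AB}+_A\overrightarrow{BC}=\overrightarrow{AC}$, defined exactly when the head of the first arrow equals the tail of the second. Axiom 1: there is a given map (arrow pre-inner product) $\langle -,-\rangle_A:\mathcal{P}_A\times\mathcal{P}_A\to\mathbb{R}$ such that for all points: $\langle\overrightarrow{AB},\overrightarrow{AB}\rangle_A\ge 0$, with equality iff $A=B$; $\langle\overrightarrow{AB},\overrightarrow{CD}\rangle_A=\langle\overrightarrow{CD},\overrightarrow{AB}\rangle_A$; $\langle\overrightarrow{AB}+_A\overrightarrow{BC},\overrightarrow{LM}\rangle_A=\langle\overrightarrow{AB},\overrightarrow{LM}\rangle_A+\langle\overrightarrow{BC},\overrightarrow{LM}\rangle_A$; $\langle-\overrightarrow{AB},\overrightarrow{CD}\rangle_A=-\langle\overrightarrow{AB},\overrightarrow{CD}\rangle_A$. Measure: $\|\overrightarrow{AB}\|_A=\sqrt{\langle\overrightarrow{AB},\overrightarrow{AB}\rangle_A}$.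 Scalar multiplication: for $t\in\mathbb{R}$, if $A=B$ or $t=0$ then $(t)\overrightarrow{AB}=\overrightarrow{AA}$. If $A\ne B$ and $t\neq0$ then $(t)\overrightarrow{AB}=\overrightarrow{AD}$, where $D\in\mathcal{P}$ is a point (assumed to exist) with $\|\overrightarrow{AD}\|_A=|t|\,\|\overrightarrow{AB}\|_A$ and $\langle\overrightarrow{AB},\overrightarrow{AD}\rangle_A=\|\overrightarrow{AB}\|_A\|\overrightarrow{AD}\|_A$ if $t>0$, $=-\|\overrightarrow{AB}\|_A\|\overrightarrow{AD}\|_A$ if $t<0$. Axiom 2: $\langle(t)\overrightarrow{AB},\overrightarrow{CD}\rangle_A=t\langle\overrightarrow{AB},\overrightarrow{CD}\rangle_A$ for all arrows and all $t\in\mathbb{R}$. Line: for distinct points $A,B$, $l_{AB}=\{C\in\mathcal{P}:\ \exists t\in\mathbb{R},\ \overrightarrow{AC}=(t)\overrightarrow{AB}\}$. Axiom 3: for every line there is a one-to-one correspondence between $\mathbb{R}$ and the set of points on the line. Relation $\Re_l$ on arrows with tail and head on the line $l$: $\overrightarrow{AB}\;\Re_l\;\overrightarrow{CD}$ iff either $A=B$ and $C=D$, or ($A\ne B$, $C\neq D$ and) $\|\overrightarrow{AB}\|_A=\|\overrightarrow{CD}\|_A$ and $\frac{\langle\overrightarrow{AB},\overrightarrow{CD}\rangle_A}{\|\overrightarrow{AB}\|_A\|\overrightarrow{CD}\|_A}=1$. *)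

(* Defs.v *)
(* Stdlib world: the scalars are the concrete real numbers [R]. *)
From Stdlib Require Import Reals.
Open Scope R_scope.

Set Implicit Arguments.

Definition arrow (P : Type) : Type := (P * P)%type.

Definition tail (P : Type) (u : arrow P) : P := fst u.
Definition head (P : Type) (u : arrow P) : P := snd u.

Definition arrow_opp (P : Type) (u : arrow P) : arrow P := (head u, tail u).

(* Partial operation: the proof argument expresses its domain. *)
Definition arrow_add (P : Type) (u v : arrow P) (h : head u = tail v) : arrow P :=
  (tail u, head v).

Record pre_inner_product (P : Type) (ip : arrow P -> arrow P -> R) : Prop := {
  ip_nonneg : forall A B : P, 0 <= ip (A, B) (A, B);
  ip_definite : forall A B : P, ip (A, B) (A, B) = 0 <-> A = B;
  ip_sym : forall u v : arrow P, ip u v = ip v u;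
  ip_add : forall (u v w : arrow P) (h : head u = tail v),
    ip (arrow_add u v h) w = ip u w + ip v w;
  ip_opp : forall u v : arrow P, ip (arrow_opp u) v = - ip u v
}.

Definition measure (P : Type) (ip : arrow P -> arrow P -> R) (u : arrow P) : R :=
  sqrt (ip u u).

(* The head [D] of [(t)AB] is only constrained, not defined explicitly, so
   scalar multiplication is an operation [smul] required to satisfy these
   clauses; in particular the required points [D] exist. *)
Record scalar_multiplication (P : Type) (ip : arrow P -> arrow P -> R)
    (smul : R -> arrow P -> arrow P) : Prop := {
  smul_degenerate : forall (t : R) (A B : P),
    A = B \/ t = 0 -> smul t (A, B) = (A, A);
  smul_proper : forall (t : R) (A B : P), A <> B -> t <> 0 ->
    exists D : P,
      smul t (A, B) = (A, D) /\
      measure ip (A, D) = Rabs t * measure ip (A, B) /\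
      (t > 0 -> ip (A, B) (A, D) = measure ip (A, B) * measure ip (A, D)) /\
      (t < 0 -> ip (A, B) (A, D) = - (measure ip (A, B) * measure ip (A, D)))
}.

Definition ip_homogeneous (P : Type) (ip : arrow P -> arrow P -> R)
    (smul : R -> arrow P -> arrow P) : Prop :=
  forall (t : R) (u v : arrow P), ip (smul t u) v = t * ip u v.

(* Meaningful as a line only when [A <> B]. *)
Definition line (P : Type) (smul : R -> arrow P -> arrow P) (A B : P) : P -> Prop :=
  fun C => exists t : R, (A, C) = smul t (A, B).

(* An arbitrary bijection is required: no compatibility with [smul] or the
   measure is imposed. *)
Definition lines_equipotent_R (P : Type) (smul : R -> arrow P -> arrow P) : Prop :=
  forall A B : P, A <> B ->
    exists f : R -> P,
      (forall s t : R, f s = f t -> s = t) /\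
      (forall C : P, line smul A B C <-> exists t : R, f t = C).

(* Relation on the arrows whose tail and head lie on [l]. *)
Definition arrow_equiv (P : Type) (ip : arrow P -> arrow P -> R) (l : P -> Prop)
    (u v : arrow P) : Prop :=
  (l (tail u) /\ l (head u) /\ l (tail v) /\ l (head v)) /\
  ((tail u = head u /\ tail v = head v) \/
   (tail u <> head u /\ tail v <> head v /\
    measure ip u = measure ip v /\
    ip u v / (measure ip u * measure ip v) = 1)).

(* Main.v *)
(* The point of [l_AB] with parameter [t] is the head of [(t)AB]. By Axiom 2 and
   additivity, the arrow from parameter [s] to parameter [t] has inner products
   [t - s] times those of [AB], so it is equivalent to [AB] exactly when
   [t - s = 1]. Hence [K] has parameter [s + 1] and [K'] has parameter [s - 1],
   where [s] is the parameter of the given point. *)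
Require Import Defs.
From Stdlib Require Import Reals Lra.
Open Scope R_scope.

Set Implicit Arguments.

(** Go from [X] to [Y] through [A] and reverse the first leg. Points of a line are given by arrows
    with tail [A], so this reduces every arrow to that form. *)
Lemma ip_common_tail (P : Type) (ip : arrow P -> arrow P -> R)
    (Hip : pre_inner_product ip) (A X Y : P) (w : arrow P) :
  ip (X, Y) w = ip (A, Y) w - ip (A, X) w.
Proof.
  pose proof (ip_add Hip (X, A) (A, Y) w eq_refl) as Hadd.
  pose proof (ip_opp Hip (A, X) w) as Hopp.
  cbn in Hadd, Hopp. unfold arrow_add, arrow_opp in *. cbn in *. lra.
Qed.

Lemma ip_pos (P : Type) (ip : arrow P -> arrow P -> R)
    (Hip : pre_inner_product ip) (A B : P) :
  A <> B -> 0 < ip (A, B) (A, B).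
Proof.
  intros HAB.
  destruct (ip_nonneg Hip A B) as [Hpos | Hzero]; [exact Hpos |].
  exfalso. apply HAB, (ip_definite Hip). now symmetry.
Qed.

Lemma smul_head (P : Type) (ip : arrow P -> arrow P -> R)
    (smul : R -> arrow P -> arrow P) (Hsmul : scalar_multiplication ip smul)
    (t : R) (A B : P) :
  A <> B -> exists D : P, (A, D) = smul t (A, B).
Proof.
  intros HAB. destruct (Req_dec t 0) as [Ht | Ht].
  - exists A. symmetry. apply (smul_degenerate Hsmul). now right.
  - destruct (smul_proper Hsmul HAB Ht) as [D [HD _]]. now exists D.
Qed.

(** If [D] is the head of [smul 1 (A, B)], homogeneity makes [(B, D)] orthogonal to every arrow,
    itself included, so definiteness gives [B = D]. This puts [B] on its own line. *)
Lemma smul_1 (P : Type) (ip : arrow P -> arrow P -> R)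
    (smul : R -> arrow P -> arrow P) (Hip : pre_inner_product ip)
    (Hsmul : scalar_multiplication ip smul) (Hhom : ip_homogeneous ip smul)
    (A B : P) :
  A <> B -> (A, B) = smul 1 (A, B).
Proof.
  intros HAB. destruct (smul_head Hsmul 1 HAB) as [D HD].
  assert (HBD : B = D).
  { apply (ip_definite Hip).
    rewrite (ip_common_tail Hip A B D), HD, Hhom. ring. }
  now rewrite <- HD, <- HBD.
Qed.

Lemma ip_line (P : Type) (ip : arrow P -> arrow P -> R)
    (smul : R -> arrow P -> arrow P) (Hip : pre_inner_product ip)
    (Hhom : ip_homogeneous ip smul) (A B X Y : P) (s t : R) (w : arrow P) :
  (A, X) = smul s (A, B) -> (A, Y) = smul t (A, B) ->
  ip (X, Y) w = (t - s) * ip (A, B) w.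
Proof.
  intros HX HY. rewrite (ip_common_tail Hip A X Y), HX, HY, !Hhom. ring.
Qed.

Lemma arrow_equiv_line_iff (P : Type) (ip : arrow P -> arrow P -> R)
    (smul : R -> arrow P -> arrow P) (Hip : pre_inner_product ip)
    (Hsmul : scalar_multiplication ip smul) (Hhom : ip_homogeneous ip smul)
    (A B X Y : P) (s t : R) :
  A <> B -> (A, X) = smul s (A, B) -> (A, Y) = smul t (A, B) ->
  arrow_equiv ip (line smul A B) (A, B) (X, Y) <-> t - s = 1.
Proof.
  intros HAB HX HY.
  pose proof (ip_pos Hip HAB) as Hpos.
  pose proof (fun w => ip_line Hip Hhom B s t w HX HY) as HXY.
  unfold arrow_equiv, measure; cbn. split.
  - intros [_ [[Heq _] | (_ & _ & Hnorm & Hcos)]]; [contradiction |].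
    (* With equal measures the denominator is [ip (A, B) (A, B)], so the quotient is exactly
       [t - s]. *)
    rewrite <- Hnorm, sqrt_sqrt, (ip_sym Hip), HXY in Hcos by lra.
    rewrite <- Hcos. field. lra.
  - intros Hst.
    (* Both arrows pair equally with every [w]; symmetry carries this to the second slot and gives
       equal measures. *)
    assert (HXYB : forall w, ip (X, Y) w = ip (A, B) w).
    { intros w. rewrite HXY, Hst. ring. }
    assert (Hnorm : ip (X, Y) (X, Y) = ip (A, B) (A, B)).
    { now rewrite HXYB, (ip_sym Hip), HXYB. }
    split.
    + repeat split.
      * exists 0. symmetry. apply (smul_degenerate Hsmul). now right.
      * exists 1. now apply smul_1 with ip.
      * now exists s.
      * now exists t.
    + right. repeat split; [exact HAB | | now rewrite Hnorm |].
      * intros Heq. apply (ip_definite Hip) in Heq. lra.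
      * rewrite Hnorm, sqrt_sqrt, (ip_sym Hip), HXYB by lra. field. lra.
Qed.

Theorem theorem40 (P : Type) (ip : arrow P -> arrow P -> R)
    (smul : R -> arrow P -> arrow P)
    (Hip : pre_inner_product ip)
    (Hsmul : scalar_multiplication ip smul)
    (Hhom : ip_homogeneous ip smul)
    (Hline : lines_equipotent_R smul)
    (A B : P) (HAB : A <> B)
    (X : P) (HX : line smul A B X) :
  (exists! K : P,
     line smul A B K /\ arrow_equiv ip (line smul A B) (A, B) (X, K)) /\
  (exists! K' : P,
     line smul A B K' /\ arrow_equiv ip (line smul A B) (A, B) (K', X)).
Proof.
  destruct HX as [s HX]. split.
  - destruct (smul_head Hsmul (s + 1) HAB) as [K HK].
    exists K. split.
    + split; [now exists (s + 1) |].
      apply (arrow_equiv_line_iff Hip Hsmul Hhom s (s + 1) HAB HX HK). ring.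
    (* The parameter of a competitor [L] is forced, and a parameter determines its point. *)
    + intros L [[t HL] Hequiv].
      apply (arrow_equiv_line_iff Hip Hsmul Hhom s t HAB HX HL) in Hequiv.
      replace t with (s + 1) in HL by lra.
      congruence.
  (* Now the given point is the head, so the unit step is taken backwards. *)
  - destruct (smul_head Hsmul (s - 1) HAB) as [K HK].
    exists K. split.
    + split; [now exists (s - 1) |].
      apply (arrow_equiv_line_iff Hip Hsmul Hhom (s - 1) s HAB HK HX). ring.
    + intros L [[t HL] Hequiv].
      apply (arrow_equiv_line_iff Hip Hsmul Hhom t s HAB HL HX) in Hequiv.
      replace t with (s - 1) in HL by lra.
      congruence.
Qed.
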